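(* For any $1<p<\infty$ and $\tau\in\mathbb{R}$ there exists a sequence $\nu_N\in\mathcal{L}_0(\mathbb{R}^{2\times2}_{sym})$ such that $$ \frac{\int\phi_1\,d\nu_N}{\int\phi_2\,d\nu_N}\;\longrightarrow\;\bigl((p^*-1)^2+\tau^2\bigr)^{p/2}\qquad\text{as }N\to\infty, $$ where, for $A\in\mathbb{R}^{2\times 2}_{sym}$ with entries $A_{ij}$, $$ \phi_1(A)=\bigl|(A_{11}-A_{22})^2+\tau^2(A_{11}+A_{22})^2\bigr|^{p/2},\qquad \phi_2(A)=|A_{11}+A_{22}|^p . $$
   Context: For $1<p<\infty$, $p^*-1:=\max\{p-1,\tfrac1{p-1}\}$. $\mathbb{R}^{2\times2}_{sym}$ is the space of real symmetric $2\times2$ matrices. A function $f:\mathbb{R}^{m\times n}\to\mathbb{R}$ is rank-one convex if $t\mapsto f(A+tB)$ is convex for all $A,B\in\mathbb{R}^{m\times n}$ with $\operatorname{rank}B=1$. For a compactly supported probability measure $\nu$ on $\mathbb{R}^{m\times n}$, its barycenter is $\overline\nu=\int X\,d\nu(X)$. Such a $\nu$ is called a laminate if $f(\overline\nu)\le\int f\,d\nu$ for all rank-one convex functions $f:\mathbb{R}^{m\times n}\to\mathbb{R}$. $\mathcal{L}_0(\mathbb{R}^{2\times2}_{sym})$ denotes the set of laminates on $2\times 2$ matrices that are supported on symmetric matrices and have barycenter $0$. *)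

(* Defs.v *)
From mathcomp Require Import all_boot all_order all_algebra.
From mathcomp Require Import all_classical all_reals all_analysis.

Set Implicit Arguments.
Unset Strict Implicit.
Unset Printing Implicit Defensive.

Import Order.TTheory GRing.Theory Num.Theory.
Import numFieldNormedType.Exports.

Local Open Scope classical_set_scope.
Local Open Scope ring_scope.

Definition borel_mx (R : realType) (m n : nat) :=
  g_sigma_algebraType (@open 'M[R]_(m, n)).

Notation mx_probability R m n := (probability (borel_mx R m n) R).

Definition rank_one_convex (R : realType) (m n : nat) (f : 'M[R]_(m, n) -> R) :=
  forall A B : 'M[R]_(m, n), \rank B = 1%N ->
    @convex_function R R^o [set: R] (fun t : R => f (A + t *: B)).

Definition mx_support (R : realType) (m n : nat) (nu : mx_probability R m n) :
    set 'M[R]_(m, n) :=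
  [set A | forall U : set 'M[R]_(m, n), open U -> U A -> (0 < nu U)%E].

(* The entrywise integral; it is only used for compactly supported [nu], for
   which every entry is integrable. *)
Definition barycenter (R : realType) (m n : nat) (nu : mx_probability R m n) :
    'M[R]_(m, n) :=
  \matrix_(i, j) \int[nu]_X (X : 'M[R]_(m, n)) i j.

(* Rank-one convex functions are continuous, hence Borel and bounded on the
   compact support of [nu]: the integral below is always well defined and
   finite, so no integrability condition on [f] is needed. *)
Definition laminate (R : realType) (m n : nat) (nu : mx_probability R m n) :=
  compact (mx_support nu) /\
  forall f : 'M[R]_(m, n) -> R, rank_one_convex f ->
    ((f (barycenter nu))%:E <= \int[nu]_X (f X)%:E)%E.

Definition laminates0_sym (R : realType) : set (mx_probability R 2 2) :=
  [set nu | [/\ laminate nu,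
                mx_support nu `<=` [set A | A^T = A] &
                barycenter nu = 0]].

(* This is p^* - 1, with p^* = max(p, p / (p - 1)) for 1 < p. *)
Definition pstar_sub1 (R : realType) (p : R) : R := Num.max (p - 1) (p - 1)^-1.

Definition phi1 (R : realType) (p tau : R) (A : 'M[R]_2) : R :=
  `|(A 0 0 - A 1 1) ^+ 2 + tau ^+ 2 * (A 0 0 + A 1 1) ^+ 2| `^ (p / 2).

Definition phi2 (R : realType) (p : R) (A : 'M[R]_2) : R :=
  `|A 0 0 + A 1 1| `^ p.

(* Main.v *)
Require Import Defs.
From HB Require Import structures.
From mathcomp Require Import all_boot all_order all_algebra.
From mathcomp Require Import all_classical all_reals all_analysis.
From mathcomp Require Import measurable_realfun ring lra.
Import Order.TTheory GRing.Theory Num.Theory.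
Import numFieldNormedType.Exports.
Local Open Scope classical_set_scope.
Local Open Scope ring_scope.

(** Restricted to diagonal matrices diag(x, y), splitting a mass along x or
along y is splitting along a rank-one line.  With u = x + y and v = x - y the
integrands are |v ^ 2 + tau ^ 2 u ^ 2| ^ (p / 2) and |u| ^ p, so on a ray
|v| = k |u| their quotient is the constant (k ^ 2 + tau ^ 2) ^ (p / 2).  It is
therefore enough to put almost all of the p-energy of a laminate with
barycenter 0 on rays with k close to p^* - 1.

This is done by a staircase.  Fix sigma = -1 (if p >= 2) or sigma = 1 (if
p < 2), a ratio lam > 1 and a slope s in ]-1, 1[.  A mass at (t, sigma t) is
split along x between (s t, sigma t) and (lam t, sigma t), and the second part
is split along y between (lam t, sigma s lam t) and (lam t, sigma lam t)
([staircase_step]).  The points (s t, sigma t) and (t, sigma s t) both lie on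
the rays |v| = k |u| with k = |s - sigma| / |s + sigma|; the point
(lam t, sigma lam t) is the start of the next step.  Each step multiplies the
moving mass by [weight_next lam s] and the distance by lam.  The slope
[critical_slope p lam] is the one for which [weight_next] is lam ^ (- p); then
every step leaves the same p-energy on the rays ([staircase_energy]).  Starting
from 0 and making M steps ([staircase_laminate]), the two integrals are
a k' M + d1 and a M + d2 with a, d1, d2 independent of M and
k' = (k ^ 2 + tau ^ 2) ^ (p / 2), so their quotient tends to k' as M grows.
Finally the critical slope tends to (p - 2) / p as lam tends to 1
([critical_slope_cvg]), and there k = p^* - 1 ([optimal_side]).

The measures are finite sums of point masses.  For these the integral of every
function, measurable or not, is the expected finite sum ([integral_atomic]), so
the inequality defining laminates is checked without a regularity theory of
rank-one convex functions. *)

(** * Finitely supported probability measures *)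

Definition weighted_sum {R : realType} {T : Type}
    (s : seq (R * T)) (f : T -> R) : R :=
  \sum_(a <- s) a.1 * f a.2.

Section AtomicMeasure.
Import HBNNSimple.
Context d (T : measurableType d) (R : realType).
Hypothesis measurable_point : forall x : T, measurable [set x].
Implicit Types (s : seq (R * T)) (f : T -> R).

Lemma measurable_finite (A : set T) : finite_set A -> measurable A.
Proof.
move=> Af; rewrite (_ : A = \bigcup_(x in A) [set x]).
  by apply: fin_bigcup_measurable.
by apply/seteqP; split => [x Ax|x [y Ay /= ->]//]; exists x.
Qed.

Lemma measurable_fun_finite_support f (A : set T) :
  finite_set A -> (forall x, ~ A x -> f x = 0) -> measurable_fun [set: T] f.
Proof.
move=> Af f0 _ B _; rewrite setTI.
have [B0|nB0] := pselect (B 0).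
  rewrite -[X in measurable X]setCK; apply/measurableC/measurable_finite.
  apply: sub_finite_set Af => x /= nBx; apply: contrapT => /f0 fx.
  by apply: nBx; rewrite /= fx.
apply: measurable_finite; apply: sub_finite_set Af => x /= Bx.
by apply: contrapT => /f0 fx; apply: nB0; rewrite -fx.
Qed.

(** The absolute values make this a measure for every list [s]; all results
are about lists with nonnegative weights. *)
Definition atomic_measure s : set T -> \bar R :=
  msum (fun i => mscale (`|(nth (0, point) s i).1|%:nng)
                        \d_((nth (0, point) s i).2)) (size s).

HB.instance Definition _ s := Measure.on (atomic_measure s).

Lemma ge0_integral_atomic_measurable s f :
    (forall a, a \in s -> 0 <= a.1) ->
    measurable_fun [set: T] f -> (forall x, 0 <= f x) ->
  (\int[atomic_measure s]_x (f x)%:E = (weighted_sum s f)%:E)%E.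
Proof.
move=> s0 mf f0; rewrite /atomic_measure ge0_integral_measure_sum//; last 2 first.
- by move=> x _; rewrite lee_fin.
- exact/measurable_EFinP.
rewrite /weighted_sum (big_nth (0, point)) big_mkord -sumEFin.
apply: eq_bigr => i _; rewrite ge0_integral_mscale//; last 2 first.
- exact/measurable_EFinP.
- by move=> x _; rewrite lee_fin.
rewrite integral_dirac//; last exact/measurable_EFinP.
by rewrite diracT mul1e/= ger0_norm// s0// mem_nth.
Qed.

(** The integral of a nonnegative function is a supremum over the simple functions
below it.  These are integrated by evaluation at the atoms, and the supremum is
reached by the restriction of [f] to the atoms, which is always measurable. *)
Lemma ge0_integral_atomic s f :
    (forall a, a \in s -> 0 <= a.1) -> (forall x, 0 <= f x) ->
  (\int[atomic_measure s]_x (f x)%:E = (weighted_sum s f)%:E)%E.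
Proof.
move=> s0 f0; pose A : set T := [set` map snd s].
pose g x := if x \in map snd s then f x else 0.
have mg : measurable_fun [set: T] g.
  apply: (@measurable_fun_finite_support g A) => [|x /negP]; first exact: finite_seq.
  by rewrite /g => /negbTE ->.
have g0 x : 0 <= g x by rewrite /g; case: ifP.
have gf x : g x <= f x by rewrite /g; case: ifP.
have eqw : weighted_sum s g = weighted_sum s f.
  apply: eq_big_seq => a sa; rewrite /g (_ : a.2 \in _)//.
  exact: map_f.
apply/eqP; rewrite eq_le; apply/andP; split.
  rewrite ge0_integralTE; last by move=> x; rewrite lee_fin.
  apply: ge_ereal_sup => _ [h/= hf <-].
  rewrite -integralT_nnsfun ge0_integral_atomic_measurable// lee_fin.
  rewrite /weighted_sum big_seq [leRHS]big_seq; apply: ler_sum => a sa.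
  by rewrite ler_wpM2l ?s0// -lee_fin.
rewrite -eqw -ge0_integral_atomic_measurable//.
rewrite !ge0_integralTE => [||x]; rewrite ?lee_fin//.
apply: ereal_sup_le => _ [h/= hg <-]; exists h => // x.
by rewrite (le_trans (hg x))// lee_fin.
Qed.

Lemma integral_atomic s f : (forall a, a \in s -> 0 <= a.1) ->
  (\int[atomic_measure s]_x (f x)%:E = (weighted_sum s f)%:E)%E.
Proof.
move=> s0; rewrite integralE (funerpos f) (funerneg f).
rewrite !(ge0_integral_atomic s)//= -EFinB; congr EFin.
rewrite /weighted_sum -sumrB; apply: eq_bigr => a _.
by rewrite -mulrBr -[in RHS](funrposBneg f).
Qed.

Lemma atomic_probability s :
    (forall a, a \in s -> 0 <= a.1) -> \sum_(a <- s) a.1 = 1 ->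
  exists P : probability T R,
    forall f, (\int[P]_x (f x)%:E = (weighted_sum s f)%:E)%E.
Proof.
move=> s0 s1; have mass1 : atomic_measure s setT = 1%E.
  rewrite -[LHS]mul1e -integral_cst//=.
  rewrite (integral_atomic s (fun=> 1))//; congr EFin.
  by rewrite -[RHS]s1; apply: eq_bigr => a _; rewrite mulr1.
pose P := HB.pack_for (probability T R) (atomic_measure s)
  (Measure_isProbability.Build _ _ _ (atomic_measure s) mass1).
by exists P => f; exact: integral_atomic.
Qed.

End AtomicMeasure.

(** * Finitely supported laminates *)

Section FiniteLaminates.
Context {R : realType}.

Lemma borel_mx_measurable_point m n (A : borel_mx R m n) : measurable [set A].
Proof.
rewrite -[X in measurable X]setCK; apply: measurableC.
apply: sub_sigma_algebra => /=.
rewrite openC; apply: compact_closed; last exact: compact_set1.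
exact: norm_hausdorff.
Qed.

Lemma rank_one_convexP {m n} (f : 'M[R]_(m, n) -> R) :
  rank_one_convex f <->
  forall A B : 'M[R]_(m, n), \rank B = 1%N -> forall t x y : R, 0 <= t <= 1 ->
    f (A + (t * x + (1 - t) * y) *: B) <=
    t * f (A + x *: B) + (1 - t) * f (A + y *: B).
Proof.
split=> fconv A B rB.
  move=> t x y /andP[t0 t1].
  have := fconv A B rB (Itv01 t0 t1) x y; rewrite !inE.
  by move=> /(_ Logic.I Logic.I).
move=> t x y _ _; have t01 : 0 <= t%:num <= 1 by apply/andP; split.
exact: fconv.
Qed.

Lemma affine_rank_one_convex {m n} (f g : 'M[R]_(m, n) -> R) :
  (forall A B t, f (A + t *: B) = f A + t * g B) -> rank_one_convex f.
Proof.
move=> fg; apply/rank_one_convexP => A B _ t x y _; rewrite !fg.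
by rewrite le_eqVlt; apply/orP; left; apply/eqP; ring.
Qed.

(** A finitely supported laminate with barycenter [A0], as a list of weights and
atoms.  That the weights add up to 1 and that the barycenter is [A0] is part of
the inequality, by [splitting_affine]. *)
Definition splitting {m n} (A0 : 'M[R]_(m, n)) (s : seq (R * 'M[R]_(m, n))) :=
  (forall a, a \in s -> 0 <= a.1) /\
  (forall f, rank_one_convex f -> f A0 <= weighted_sum s f).

(** An affine function and its opposite are both rank-one convex, so that the
inequality for rank-one convex functions becomes an equality. *)
Lemma splitting_affine {m n} (A0 : 'M[R]_(m, n)) s f g : splitting A0 s ->
  (forall A B t, f (A + t *: B) = f A + t * g B) -> weighted_sum s f = f A0.
Proof.
move=> [_ sA0] fg; apply/eqP; rewrite eq_le; apply/andP; split; last first.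
  by apply: sA0; apply: affine_rank_one_convex fg.
rewrite -lerN2 /weighted_sum -sumrN; under eq_bigr do rewrite -mulrN.
apply: (sA0 (fun A => - f A)).
apply: (affine_rank_one_convex _ (fun B => - g B)) => A B t.
by rewrite fg opprD mulrN.
Qed.

Lemma splitting_laminate {m n} (A0 : 'M[R]_(m, n)) s : splitting A0 s ->
  exists nu : mx_probability R m n,
    [/\ laminate nu, barycenter nu = A0,
        mx_support nu `<=` [set` map snd s] &
        forall f : 'M[R]_(m, n) -> R, \int[nu]_X f X = weighted_sum s f].
Proof.
move=> sA0; have [s0 sconv] := sA0.
have s1 : \sum_(a <- s) a.1 = 1.
  rewrite -(splitting_affine A0 s (fun=> 1) (fun=> 0))//.
    by apply: eq_bigr => a _; rewrite mulr1.
  by move=> *; rewrite mulr0 addr0.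
have [nu int_nu] := @atomic_probability _ (borel_mx R m n) R
  (@borel_mx_measurable_point m n) s s0 s1.
have Rint_nu (f : 'M[R]_(m, n) -> R) : \int[nu]_X f X = weighted_sum s f.
  by rewrite /Rintegral int_nu.
have bar_nu : barycenter nu = A0.
  apply/matrixP => i j; rewrite mxE Rint_nu.
  apply: (splitting_affine _ _ (fun B : 'M[R]_(m, n) => B i j) (fun B => B i j) sA0).
  by move=> A B t; rewrite !mxE.
have supp_nu : mx_support nu `<=` [set` map snd s].
  move=> A suppA; apply: contrapT => sA.
  have oU : open (~` [set` map snd s] : set 'M[R]_(m, n)).
    rewrite openC; apply: compact_closed; first exact: norm_hausdorff.
    exact/finite_compact/finite_seq.
  have /= := suppA _ oU sA; apply/negP; rewrite -leNgt.
  have mU : measurable (~` [set` map snd s] : set (borel_mx R m n)).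
    by apply: sub_sigma_algebra.
  have := integral_indic nu measurableT mU; rewrite setIT => <-.
  rewrite (int_nu \1_(~` [set` map snd s])) lee_fin.
  rewrite /weighted_sum big_seq big1// => a sa.
  by rewrite indicE memNset ?mulr0//=; apply; exact: map_f.
exists nu; split => //; split.
  by apply: finite_compact; apply: sub_finite_set supp_nu _; exact: finite_seq.
by move=> f fconv; rewrite bar_nu int_nu lee_fin; exact: sconv.
Qed.

End FiniteLaminates.

(** * The staircase of diagonal matrices *)

Section Staircase.
Context {R : realType}.
Implicit Types (f : 'M[R]_2 -> R) (t w x y p : R).

Definition diag2 x y : 'M[R]_2 := x *: delta_mx 0 0 + y *: delta_mx 1 1.

Lemma diag2_tr x y : (diag2 x y)^T = diag2 x y.
Proof. by rewrite /diag2 linearD !linearZ/= !trmx_delta. Qed.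

Lemma diag2_00 x y : diag2 x y 0 0 = x.
Proof. by rewrite !mxE/= mulr1 mulr0 addr0. Qed.

Lemma diag2_11 x y : diag2 x y 1 1 = y.
Proof. by rewrite !mxE/= mulr1 mulr0 add0r. Qed.

Lemma rank_one_convex_diag1 f y t x1 x2 : rank_one_convex f -> 0 <= t <= 1 ->
  f (diag2 (t * x1 + (1 - t) * x2) y) <=
  t * f (diag2 x1 y) + (1 - t) * f (diag2 x2 y).
Proof.
move=> /rank_one_convexP fconv t01; rewrite /diag2 ![_ + y *: _]addrC.
by apply: fconv => //; rewrite mxrank_delta.
Qed.

Lemma rank_one_convex_diag2 f x t y1 y2 : rank_one_convex f -> 0 <= t <= 1 ->
  f (diag2 x (t * y1 + (1 - t) * y2)) <=
  t * f (diag2 x y1) + (1 - t) * f (diag2 x y2).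
Proof.
by move=> /rank_one_convexP fconv t01; apply: fconv => //; rewrite mxrank_delta.
Qed.

Variables (sigma lam s : R).

(** Of a unit mass at (t, sigma t), [weight_row] stays at (s t, sigma t),
[weight_col] stays at (lam t, sigma s lam t), and [weight_next] arrives at
(lam t, sigma lam t). *)
Definition weight_row := (lam - 1) / (lam - s).
Definition weight_col := (lam - 1) / (lam * (lam - s)).
Definition weight_next := (1 - s * lam) / (lam * (lam - s)).

Fixpoint staircase (M : nat) w t : seq (R * 'M[R]_2) :=
  if M is M'.+1 then
    [:: (w * weight_row, diag2 (s * t) (sigma * t)),
        (w * weight_col, diag2 (lam * t) (sigma * (s * (lam * t)))) &
        staircase M' (w * weight_next) (lam * t)]
  else [:: (w, diag2 t (sigma * t))].

Hypotheses (lam1 : 1 < lam) (s1 : s < 1) (slam1 : s * lam < 1).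

Let lam_gt0 : 0 < lam. Proof. exact: lt_trans lam1. Qed.

Let lam_s : 0 < lam - s. Proof. by rewrite subr_gt0 (lt_trans s1). Qed.

Let lam_lam_s : 0 < lam * (lam - s). Proof. exact: mulr_gt0. Qed.

Lemma weight_row_gt0 : 0 < weight_row.
Proof. by rewrite divr_gt0// subr_gt0. Qed.

Lemma weight_col_gt0 : 0 < weight_col.
Proof. by rewrite divr_gt0// subr_gt0. Qed.

Lemma weight_next_gt0 : 0 < weight_next.
Proof. by rewrite divr_gt0// subr_gt0. Qed.

(** Two rank-one splittings in a row: along the first diagonal entry with
proportion [weight_row], then along the second one. *)
Lemma staircase_step f t : rank_one_convex f ->
  f (diag2 t (sigma * t)) <=
    weight_row * f (diag2 (s * t) (sigma * t))
    + weight_col * f (diag2 (lam * t) (sigma * (s * (lam * t))))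
    + weight_next * f (diag2 (lam * t) (sigma * (lam * t))).
Proof.
move=> fconv; have [[[l1 s1'] sl1] ls0] := (lam1, s1, slam1, lam_s).
have lam0 : lam != 0 by rewrite gt_eqF.
have lams0 : lam - s != 0 by rewrite gt_eqF.
have s0 : 1 - s != 0 by apply/eqP; lra.
have row01 : 0 <= weight_row <= 1.
  by rewrite ltW ?weight_row_gt0//= ler_pdivrMr//; lra.
(* proportion of the second splitting: sigma t lies between sigma s lam t and
   sigma lam t *)
pose theta := (lam - 1) / (lam * (1 - s)).
have ls_gt0 : 0 < lam * (1 - s) by rewrite mulr_gt0//; lra.
have theta01 : 0 <= theta <= 1.
  apply/andP; split; first by rewrite divr_ge0//; lra.
  by rewrite ler_pdivrMr//; lra.
have row_split := @rank_one_convex_diag1 f (sigma * t) _ (s * t) (lam * t) fconv row01.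
have col_split := @rank_one_convex_diag2 f (lam * t) _
  (sigma * (s * (lam * t))) (sigma * (lam * t)) fconv theta01.
rewrite (_ : _ * (s * t) + _ = t) in row_split; last first.
  by rewrite /weight_row; field.
rewrite (_ : theta * _ + _ = sigma * t) in col_split; last first.
  by rewrite /theta; field; rewrite ?lam0 ?lams0 ?s0.
have row1 : 0 <= 1 - weight_row by lra.
have := ler_wpM2l row1 col_split.
rewrite mulrDr (mulrA _ theta) (mulrA _ (1 - theta)).
rewrite (_ : (1 - weight_row) * theta = weight_col); last first.
  by rewrite /weight_row /weight_col /theta; field; rewrite ?lam0 ?lams0 ?s0.
rewrite (_ : (1 - weight_row) * (1 - theta) = weight_next); last first.
  by rewrite /weight_row /weight_next /theta; field; rewrite ?lam0 ?lams0 ?s0.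
lra.
Qed.

Lemma weighted_sum_cons (T : Type) (a : R * T) (l : seq (R * T)) (g : T -> R) :
  weighted_sum (a :: l) g = a.1 * g a.2 + weighted_sum l g.
Proof. by rewrite /weighted_sum big_cons. Qed.

Lemma weighted_sum1 (T : Type) (a : R * T) (g : T -> R) :
  weighted_sum [:: a] g = a.1 * g a.2.
Proof. by rewrite /weighted_sum big_seq1. Qed.

Lemma staircase_convex f M w t : rank_one_convex f -> 0 <= w ->
  w * f (diag2 t (sigma * t)) <= weighted_sum (staircase M w t) f.
Proof.
move=> fconv; elim: M w t => [|M IHM] w t w0; first by rewrite weighted_sum1.
rewrite /= !weighted_sum_cons/=.
have := ler_wpM2l w0 (staircase_step _ t fconv).
have := IHM (w * weight_next) (lam * t) (mulr_ge0 w0 (ltW weight_next_gt0)).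
by rewrite !mulrDr -!mulrA; lra.
Qed.

Lemma staircase_ge0 M w t a : 0 <= w -> a \in staircase M w t -> 0 <= a.1.
Proof.
elim: M w t => [|M IHM] w t w0 /=; first by rewrite inE => /eqP ->.
rewrite !inE => /or3P[/eqP ->|/eqP ->|]/=.
- by rewrite mulr_ge0// ltW// weight_row_gt0.
- by rewrite mulr_ge0// ltW// weight_col_gt0.
- by apply: IHM; rewrite mulr_ge0// ltW// weight_next_gt0.
Qed.

Lemma staircase_diag M w t a : a \in staircase M w t -> a.2^T = a.2.
Proof.
elim: M w t => [|M IHM] w t /=.
  by rewrite inE => /eqP ->; rewrite diag2_tr.
by rewrite !inE => /or3P[/eqP ->|/eqP ->|/IHM//]; rewrite diag2_tr.
Qed.

Definition homogeneous p f :=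
  forall c x y, 0 < c -> f (diag2 (c * x) (c * y)) = c `^ p * f (diag2 x y).

(** What the first step leaves behind from a unit mass at (1, sigma); the power of
[lam] is there because the second point is (lam, sigma s lam). *)
Definition step_energy p f :=
  weight_row * f (diag2 s sigma) + weight_col * lam `^ p * f (diag2 1 (sigma * s)).

(** If the mass decreases exactly like the p-th power of the distance, a
p-homogeneous integrand gets the same contribution from every step, and the
last point contributes as much as the first one would. *)
Lemma staircase_energy p f M w t :
    homogeneous p f -> weight_next * lam `^ p = 1 -> 0 < t ->
  weighted_sum (staircase M w t) f =
  w * t `^ p * (M%:R * step_energy p f + f (diag2 1 sigma)).
Proof.
move=> fp crit; elim: M w t => [|M IHM] w t t0.
  rewrite weighted_sum1/= mul0r add0r -mulrA -fp//.
  by rewrite mulr1 (mulrC t).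
have lt0 : 0 < lam * t by rewrite mulr_gt0.
have row_pt : f (diag2 (s * t) (sigma * t)) = t `^ p * f (diag2 s sigma).
  by rewrite -fp// !(mulrC t).
have col_pt : f (diag2 (lam * t) (sigma * (s * (lam * t)))) =
    (lam * t) `^ p * f (diag2 1 (sigma * s)).
  by rewrite -fp// mulr1; congr (f (diag2 _ _)); ring.
rewrite /= !weighted_sum_cons/= IHM// row_pt col_pt.
rewrite powRM ?ltW//.
rewrite (_ : w * weight_next * _ = w * t `^ p * (weight_next * lam `^ p)); last by ring.
rewrite crit -[M.+1]addn1 natrD /step_energy; ring.
Qed.

(** From 0 to the start (1, sigma) of a staircase: 0 is split into (-1, 0) and
(1, 0), and (1, 0) into (1, - sigma) and (1, sigma). *)
Definition staircase_laminate M : seq (R * 'M[R]_2) :=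
  [:: (2^-1, diag2 (-1) 0), (4^-1, diag2 1 (- sigma)) & staircase M 4^-1 1].

Lemma staircase_laminate_splitting M : splitting 0 (staircase_laminate M).
Proof.
split=> [a|f fconv].
  rewrite !inE => /or3P[/eqP ->|/eqP ->|]/=; rewrite ?invr_ge0//.
  by apply: staircase_ge0; rewrite invr_ge0.
rewrite !weighted_sum_cons/=.
have h01 : 0 <= (2^-1 : R) <= 1 by apply/andP; split; lra.
have := @rank_one_convex_diag1 f 0 _ (-1) 1 fconv h01.
have := @rank_one_convex_diag2 f 1 _ (- sigma) sigma fconv h01.
rewrite (_ : 2^-1 * - sigma + _ = 0); last by field.
rewrite (_ : 2^-1 * -1 + _ = 0); last by field.
have -> : diag2 0 0 = 0 by rewrite /diag2 !scale0r addr0.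
have := @staircase_convex f M 4^-1 1 fconv.
rewrite mulr1 => /(_ ltac:(by rewrite invr_ge0)).
lra.
Qed.

End Staircase.

(** * The two integrands on the staircase *)

Section Energies.
Context {R : realType}.
Implicit Types (p tau x y k : R).

Lemma sqr_powR_half p x : (x ^+ 2) `^ (p / 2) = `|x| `^ p.
Proof.
by rewrite -real_normK ?num_real// -powR_mulrn// -powRrM mulrC divfK ?pnatr_eq0.
Qed.

Lemma phi2_diag2 p x y : phi2 p (diag2 x y) = `|x + y| `^ p.
Proof. by rewrite /phi2 diag2_00 diag2_11. Qed.

Lemma phi1_diag2 p tau x y :
  phi1 p tau (diag2 x y) = ((x - y) ^+ 2 + tau ^+ 2 * (x + y) ^+ 2) `^ (p / 2).
Proof.
rewrite /phi1 diag2_00 diag2_11 ger0_norm//.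
exact: addr_ge0 (sqr_ge0 _) (mulr_ge0 (sqr_ge0 _) (sqr_ge0 _)).
Qed.

Lemma phi2_homogeneous p : homogeneous p (@phi2 R p).
Proof.
by move=> c x y c0; rewrite !phi2_diag2 -mulrDr normrM gtr0_norm// powRM// ltW.
Qed.

Lemma phi1_homogeneous p tau : homogeneous p (@phi1 R p tau).
Proof.
move=> c x y c0; rewrite !phi1_diag2.
rewrite (_ : _ + _ = c ^+ 2 * ((x - y) ^+ 2 + tau ^+ 2 * (x + y) ^+ 2)); last by ring.
rewrite powRM ?sqr_ge0//; last first.
  exact: addr_ge0 (sqr_ge0 _) (mulr_ge0 (sqr_ge0 _) (sqr_ge0 _)).
by rewrite sqr_powR_half gtr0_norm.
Qed.

(** The value of the quotient of the two integrands on the rays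
|x - y| = |k| |x + y|. *)
Definition ray_ratio p tau k := (k ^+ 2 + tau ^+ 2) `^ (p / 2).

Lemma phi1_ray p tau k x y : (x - y) ^+ 2 = k ^+ 2 * (x + y) ^+ 2 ->
  phi1 p tau (diag2 x y) = ray_ratio p tau k * phi2 p (diag2 x y).
Proof.
move=> xy; rewrite phi1_diag2 phi2_diag2 xy -mulrDl.
by rewrite powRM ?addr_ge0 ?sqr_ge0// sqr_powR_half.
Qed.

Lemma step_energy_ratio p tau sigma lam s :
  sigma ^+ 2 = 1 -> s + sigma != 0 ->
  step_energy sigma lam s p (phi1 p tau) =
  ray_ratio p tau ((s - sigma) / (s + sigma)) *
    step_energy sigma lam s p (phi2 p).
Proof.
move=> sg2 ssg; rewrite /step_energy.
have row_ray : (s - sigma) ^+ 2 = ((s - sigma) / (s + sigma)) ^+ 2 * (s + sigma) ^+ 2.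
  by field.
have col_ray : (1 - sigma * s) ^+ 2 =
    ((s - sigma) / (s + sigma)) ^+ 2 * (1 + sigma * s) ^+ 2.
  have -> : 1 - sigma * s = sigma * (sigma - s) by rewrite -sg2; ring.
  have -> : 1 + sigma * s = sigma * (sigma + s) by rewrite -sg2; ring.
  by field.
by rewrite (phi1_ray p tau _ _ _ row_ray) (phi1_ray p tau _ _ _ col_ray); ring.
Qed.

Lemma staircase_laminate_energy p (f : 'M[R]_2 -> R) sigma lam s M : 1 < lam ->
    homogeneous p f -> weight_next lam s * lam `^ p = 1 ->
  weighted_sum (staircase_laminate sigma lam s M) f =
  4^-1 * step_energy sigma lam s p f * M%:R + (2^-1 * f (diag2 (-1) 0) +
    4^-1 * f (diag2 1 (- sigma)) + 4^-1 * f (diag2 1 sigma)).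
Proof.
move=> lam1 fp crit; rewrite !weighted_sum_cons/= (staircase_energy _ _ _ lam1 p)//.
by rewrite powR1; ring.
Qed.

End Energies.

(** * The critical slope *)

Section CriticalSlope.
Context {R : realType}.
Implicit Types (p lam : R).

(** The solution [s] of [weight_next lam s * lam `^ p = 1], an equation that
becomes linear in [s] once the denominator is cleared. *)
Definition critical_slope p lam := (lam `^ (p - 1) - lam) / (lam `^ p - 1).

Lemma powR_gt1 lam p : 1 < lam -> 0 < p -> 1 < lam `^ p.
Proof.
move=> lam1 p0; have := @gt0_ltr_powR R p p0 1 lam.
by rewrite powR1; apply => //; rewrite nnegrE ltW// (lt_trans _ lam1).
Qed.

(** With u = lam ^ (p - 1) > 1 and lam ^ p = lam u, the bounds reduce to
(lam + 1) (u - 1) > 0, (lam - 1) (u + 1) > 0 and lam ^ 2 > 1. *)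
Lemma critical_slopeP p lam : 1 < p -> 1 < lam ->
  let s := critical_slope p lam in
  [/\ -1 < s, s < 1, s * lam < 1 & weight_next lam s * lam `^ p = 1].
Proof.
move=> p1 lam1 s.
have u1 : 1 < lam `^ (p - 1) by apply: powR_gt1 => //; lra.
have lamp : lam `^ p = lam * lam `^ (p - 1) by rewrite mulr_powRB1//; lra.
rewrite /s /critical_slope /weight_next lamp.
set u := lam `^ (p - 1) in u1 *.
have lu : 0 < lam * u - 1 by nra.
split.
- by rewrite ltr_pdivlMr//; nra.
- by rewrite ltr_pdivrMr//; nra.
- by rewrite mulrAC ltr_pdivrMr//; nra.
- have d1 : lam * u - 1 != 0 by rewrite gt_eqF.
  have d2 : lam - (u - lam) / (lam * u - 1) = u * (lam ^+ 2 - 1) / (lam * u - 1).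
    by field.
  have d3 : 1 - (u - lam) / (lam * u - 1) * lam = (lam ^+ 2 - 1) / (lam * u - 1).
    by field.
  have d4 : lam ^+ 2 - 1 != 0 by rewrite gt_eqF//; nra.
  rewrite d2 d3; field; rewrite d1 d4/=; apply/andP; split; apply/eqP; lra.
Qed.

Lemma powR_quotient_cvg (a : R) :
  h^-1 * ((h + 1) `^ a - 1) @[h --> 0^'] --> a.
Proof.
have [dpow dpowE] := is_derive1_powR a (@ltr01 R).
have : h^-1 *: (((@powR R ^~ a) \o shift 1) (h *: 1) - 1 `^ a) @[h --> 0^'] -->
  'D_1 (@powR R ^~ a) 1 := dpow.
rewrite dpowE powR1 mulr1 => quot.
apply: cvg_trans quot; apply: near_eq_cvg; near=> h.
by rewrite /= /GRing.scale/= mulr1.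
Unshelve. all: by end_near. Qed.

(** Divided by h, the numerator and the denominator of the slope at h + 1 become
difference quotients at 1 of x ^ (p - 1) - x and of x ^ p. *)
Lemma critical_slope_cvg p : 1 < p ->
  critical_slope p (h + 1) @[h --> 0^'] --> (p - 2) / p.
Proof.
move=> p1.
have num := powR_quotient_cvg (p - 1).
have den := powR_quotient_cvg p.
have p0 : p != 0 by apply/eqP; lra.
have quot : (h^-1 * ((h + 1) `^ (p - 1) - 1) - 1) /
    (h^-1 * ((h + 1) `^ p - 1)) @[h --> 0^'] --> (p - 2) / p.
  rewrite (_ : p - 2 = p - 1 - 1); last by ring.
  by apply: cvgM; [apply: cvgB => //; exact: cvg_cst|exact: cvgV].
apply: cvg_trans quot; apply: near_eq_cvg; near=> h.
have h0 : h != 0 by near: h; exact: nbhs_dnbhs_neq.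
have -> : h^-1 * ((h + 1) `^ (p - 1) - 1) - 1 = h^-1 * ((h + 1) `^ (p - 1) - (h + 1)).
  by field.
by rewrite -mulf_div divff ?invr_eq0// mul1r.
Unshelve. all: by end_near. Qed.

Lemma powR_continuous_at (a c : R) : 0 < c -> {for c, continuous (fun x => x `^ a)}.
Proof.
move=> c0; apply: differentiable_continuous; apply/derivable1_diffP.
by have [] := is_derive1_powR a c0.
Qed.

End CriticalSlope.

(** * Letting the staircase become long and fine *)

Section Sharpness.
Context {R : realType}.
Implicit Types (p tau : R).

Lemma ray_ratio_cvg p tau sigma : 1 < p ->
    (p - 2) / p + sigma != 0 -> (p - 2) / p - sigma != 0 ->
  ray_ratio p tau ((critical_slope p (h + 1) - sigma) /
                   (critical_slope p (h + 1) + sigma)) @[h --> 0^'] -->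
  ray_ratio p tau (((p - 2) / p - sigma) / ((p - 2) / p + sigma)).
Proof.
move=> p1 sg1 sg2; have slope_cvg := critical_slope_cvg p p1.
rewrite /ray_ratio; set k0 := ((p - 2) / p - sigma) / ((p - 2) / p + sigma).
have k0_neq0 : k0 != 0 by rewrite mulf_neq0// invr_eq0.
have pos : 0 < k0 ^+ 2 + tau ^+ 2.
  by rewrite ltr_wpDr ?sqr_ge0// lt_neqAle eq_sym sqrf_eq0 k0_neq0 sqr_ge0.
have k_cvg : (critical_slope p (h + 1) - sigma) / (critical_slope p (h + 1) + sigma)
    @[h --> 0^'] --> k0.
  apply: cvgM; first by apply: cvgB => //; exact: cvg_cst.
  by apply: cvgV => //; apply: cvgD => //; exact: cvg_cst.
apply: (continuous_cvg _ (powR_continuous_at (p / 2) _ pos)).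
apply: cvgD; last exact: cvg_cst.
by under eq_fun do rewrite expr2; rewrite expr2; apply: cvgM.
Qed.

(** At the limit slope (p - 2) / p the rays have k = p - 1 for sigma = -1 and
k = 1 / (p - 1) for sigma = 1; the sign of p - 2 decides which one is larger. *)
Lemma optimal_side p : 1 < p -> exists2 sigma : R, sigma ^+ 2 = 1 &
  (((p - 2) / p - sigma) / ((p - 2) / p + sigma)) ^+ 2 = pstar_sub1 p ^+ 2.
Proof.
move=> p1; have p0 : p != 0 by apply/eqP; lra.
have p10 : p - 1 != 0 by apply/eqP; lra.
have inv_gt0 : 0 < (p - 1)^-1 by rewrite invr_gt0; lra.
have inv1 : (p - 1)^-1 * (p - 1) = 1 by rewrite mulVf.
have [p2|p2] := leP 2 p.
  exists (-1); first by ring.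
  rewrite /pstar_sub1 max_l; last by nra.
  rewrite (_ : (_ - _) / _ = - (p - 1)) ?sqrrN//.
  field; rewrite p0/=; apply/eqP; lra.
exists 1; first by ring.
rewrite /pstar_sub1 max_r; last by nra.
rewrite (_ : (_ - _) / _ = - (p - 1)^-1) ?sqrrN//.
field; rewrite p0 p10/=; apply/eqP; lra.
Qed.

Lemma add_unit_neq0 (s sigma : R) :
  -1 < s -> s < 1 -> sigma ^+ 2 = 1 -> s + sigma != 0.
Proof.
move=> s_gt s_lt sg; apply/eqP => /eqP; rewrite addr_eq0 => /eqP s_eq.
have : s ^+ 2 = 1 by rewrite s_eq sqrrN.
nra.
Qed.

(** The difference is (d1 - k d2) / (a M + d2). *)
Lemma quotient_affine_close (a k d1 d2 e : R) : 0 < a -> 0 < d2 -> 0 < e ->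
  exists M : nat, `|(a * k * M%:R + d1) / (a * M%:R + d2) - k| < e.
Proof.
move=> a0 d20 e0; pose D := `|d1 - k * d2|.
have D0 : 0 <= D / (e * a) by rewrite divr_ge0 ?normr_ge0// ltW// mulr_gt0.
exists (Num.bound (D / (e * a))); have := archi_boundP D0.
set M := (X in X%:R) => DM.
have den0 : 0 < a * M%:R + d2 by rewrite ltr_wpDl// mulr_ge0// ltW.
rewrite (_ : _ - k = (d1 - k * d2) / (a * M%:R + d2)); last first.
  by field; rewrite gt_eqF.
rewrite normrM normfV (gtr0_norm den0) ltr_pdivrMr// -/D mulrDr mulrA.
move: DM; rewrite ltr_pdivrMr ?mulr_gt0// mulrC => /lt_trans; apply.
by rewrite ltrDl mulr_gt0.
Qed.

(** First [lam] is taken so close to 1 that the ratio on the rays is within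
e / 2 of its limit; for this [lam] the number of steps is then taken large. *)
Lemma laminate_approx p tau (e : R) : 1 < p -> 0 < e ->
  exists nu : mx_probability R 2 2,
    [/\ laminates0_sym nu, 0 < \int[nu]_A phi2 p A &
        `|(\int[nu]_A phi1 p tau A) / (\int[nu]_A phi2 p A) -
          (pstar_sub1 p ^+ 2 + tau ^+ 2) `^ (p / 2)| < e].
Proof.
move=> p1 e0; have [sigma sg2 <-] := optimal_side p p1.
have NsgN2 : (- sigma) ^+ 2 = 1 by rewrite sqrrN.
rewrite -/(ray_ratio p tau _).
have lim_gt : -1 < (p - 2) / p by rewrite ltr_pdivlMr; lra.
have lim_lt : (p - 2) / p < 1 by rewrite ltr_pdivrMr; lra.
have e20 : 0 < e / 2 by rewrite divr_gt0.
have /cvg_dnbhs_at_right/cvgrPdist_lt/(_ _ e20) near_lim :=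
  ray_ratio_cvg p tau sigma p1 (add_unit_neq0 _ _ lim_gt lim_lt sg2)
    (add_unit_neq0 _ _ lim_gt lim_lt NsgN2).
have [h [/= h0 h_close]] := filter_ex (filterI (nbhs_right_gt (0 : R)) near_lim).
have lam1 : 1 < h + 1 by lra.
set lam := h + 1 in h_close lam1 *; pose s := critical_slope p lam.
have [s_gt s_lt slam crit] := critical_slopeP p lam p1 lam1.
rewrite -/s in s_gt s_lt slam crit h_close.
set k := (X in _ - ray_ratio p tau X) in h_close.
have ssg := add_unit_neq0 _ _ s_gt s_lt sg2.
pose c := step_energy sigma lam s p (phi2 p).
have c0 : 0 < c.
  rewrite /c /step_energy !phi2_diag2 ltr_wpDr//.
    apply: mulr_ge0; last exact: powR_ge0.
    by apply: mulr_ge0; [exact/ltW/weight_col_gt0|exact: powR_ge0].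
  by apply: mulr_gt0; [exact: weight_row_gt0|rewrite powR_gt0// normr_gt0].
pose rest (f : 'M[R]_2 -> R) := 2^-1 * f (diag2 (-1) 0) +
  4^-1 * f (diag2 1 (- sigma)) + 4^-1 * f (diag2 1 sigma).
have rest0 : 0 < rest (phi2 p).
  rewrite /rest !phi2_diag2 addr0 normrN1 powR1 mulr1 -addrA.
  apply: ltr_wpDr; last by rewrite invr_gt0.
  by apply: addr_ge0; apply: mulr_ge0; rewrite ?invr_ge0// powR_ge0.
have [M closeM] := @quotient_affine_close (4^-1 * c) (ray_ratio p tau k)
  (rest (phi1 p tau)) (rest (phi2 p)) (e / 2) ltac:(by rewrite mulr_gt0) rest0 e20.
have [nu [nu_lam nu0 nu_supp nu_int]] :=
  splitting_laminate _ _ (staircase_laminate_splitting sigma lam s lam1 s_lt slam M).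
have E1 : \int[nu]_A phi1 p tau A =
    4^-1 * c * ray_ratio p tau k * M%:R + rest (phi1 p tau).
  rewrite nu_int (staircase_laminate_energy p)//; last exact: phi1_homogeneous.
  by rewrite step_energy_ratio// -/c -/k -/(rest _); ring.
have E2 : \int[nu]_A phi2 p A = 4^-1 * c * M%:R + rest (phi2 p).
  by rewrite nu_int (staircase_laminate_energy p)//; exact: phi2_homogeneous.
exists nu; split.
- split => // A /nu_supp /= Aatoms; have /mapP[a sa ->] :
    A \in map snd (staircase_laminate sigma lam s M) by [].
  move: sa; rewrite !inE => /or3P[/eqP ->|/eqP ->|/staircase_diag//];
    exact: diag2_tr.
- by rewrite E2 ltr_wpDl// mulr_ge0// mulr_ge0// ltW.
- rewrite E1 E2 (le_lt_trans (ler_distD (ray_ratio p tau k) _ _))//.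
  by rewrite [ltRHS](splitr e) ltrD// distrC.
Qed.

End Sharpness.

Theorem theorem8 (R : realType) (p tau : R) (hp : 1 < p) :
  exists nu : nat -> mx_probability R 2 2,
    [/\ forall N, laminates0_sym (nu N),
        forall N, 0 < \int[nu N]_A phi2 p A &
        (fun N => (\int[nu N]_A phi1 p tau A) / (\int[nu N]_A phi2 p A))
          @ \oo --> (pstar_sub1 p ^+ 2 + tau ^+ 2) `^ (p / 2)].
Proof.
have /choice[nu nuP] : forall N : nat, exists nu : mx_probability R 2 2,
    [/\ laminates0_sym nu, 0 < \int[nu]_A phi2 p A &
        `|(\int[nu]_A phi1 p tau A) / (\int[nu]_A phi2 p A) -
          (pstar_sub1 p ^+ 2 + tau ^+ 2) `^ (p / 2)| < N.+1%:R^-1].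
  by move=> N; apply: laminate_approx => //; rewrite invr_gt0.
exists nu; split => [N|N|]; [by case: (nuP N)|by case: (nuP N)|].
apply/cvgrPdist_lt => e e0; near=> N.
have [_ _ close] := nuP N; rewrite distrC (lt_trans close)//.
near: N; exact: (near_infty_natSinv_lt (PosNum e0)).
Unshelve. all: by end_near. Qed.
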